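(* Let $S$ be a Kulikov surface with Kulikov morphism $F_S:S\to\mathbb{C}^2$ (defined in the context), let $B$ be the ring of regular functions on $S$ (a factorial affine domain over $\mathbb{C}$), let $\phi_S:\mathbb{C}[\mathbb{C}^2]\to B$ be the ring morphism induced by $F_S$, and let $A$ be the image of $\phi_S$ (a factorial subring of $B$). Then $A$ is not multiplicatively closed in $B$, or equivalently there exists a prime element of $A$ which is not prime in $B$.
   Context: **Multiplicatively closed.** A subring $A$ of a domain $B$ is multiplicatively closed in $B$ if for all non-zero $b,b'\in B$ with $bb'\in A$ one has $b,b'\in A$. For factorial domains $A\subset B$ with the same invertible elements and such that $\mathrm{Spec}\,B\to\mathrm{Spec}\,A$ is unramified, this is equivalent to each irreducible element of $A$ being irreducible in $B$. Factorial means unique factorization domain. **Kulikov surfaces and morphisms.** Let $\mathbb{P}_2=\mathbb{P}_2(\mathbb{C})$ with homogeneous coordinates $X_1,X_2,X_3$, let $P=(1:1:1)$, and for $1\le i\le 3$ let $Q_i = 3X_i^2 - X_1X_2 - X_1X_3 - X_2X_3$ (three conics passing through $P$). Let $\phi : \mathbb{P}_2 - \{P\} \to \mathbb{P}_2$ be the morphism $x \mapsto (Q_1(x):Q_2(x):Q_3(x))$. Let $R$ be the Zariski closure in $\mathbb{P}_2$ of the set of ramification points of $\phi$; it is the cubic with a node at $P$ defined by $\sum_{i\ne j} X_i^2X_j - 6X_1X_2X_3$. Let $Q = a_1Q_1+a_2Q_2+a_3Q_3$ be a generic linear combination with complex coefficients, and let $C$ be the conic defined by $Q$. It passes through $P$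 and meets $R$ transversely at each point of their intersection (at the node $P$: transversely to both branches of $R$), and $\phi$ maps the complement of $C$ in $\mathbb{P}_2$ into the complement of a line $L$ of $\mathbb{P}_2$ (namely $L : a_1Y_1+a_2Y_2+a_3Y_3=0$ in the target coordinates $Y_1,Y_2,Y_3$). Let $\sigma : \tilde{\mathbb{P}}_2 \to \mathbb{P}_2$ be the blowing-up of $P$, $E=\sigma^{-1}(P)$ the exceptional curve, and $\tilde R$, $\tilde C$ the strict transforms of $R$, $C$ by $\sigma$ (the irreducible curves with $\sigma^{-1}(R)=E\cup\tilde R$ and $\sigma^{-1}(C)=E\cup\tilde C$). The surface $S = \tilde{\mathbb{P}}_2 - (\tilde R\cup\tilde C)$ is called a Kulikov surface. The map $\phi\circ\sigma$ extends to $\tilde{\mathbb{P}}_2$ and induces an unramified morphism $F_S : S \to \mathbb{P}_2 - L \cong \mathbb{C}^2$ of geometric degree $3$, called the Kulikov morphism on $S$. *)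

(* Defs.v *)
From HB Require Import structures.
From mathcomp Require Import all_boot all_order all_algebra.
From mathcomp Require Import boolp classical_sets functions reals.
From mathcomp Require Import complex.
From mathcomp Require Import freeg mpoly.
From mathcomp Require Import ring.

Set Implicit Arguments.
Unset Strict Implicit.
Unset Printing Implicit Defensive.

Import GRing.Theory.
Local Open Scope ring_scope.
Local Open Scope classical_set_scope.

(* Subrings of a commutative ring, given as subsets of it. *)
Section Subrings.
Variable T : comPzRingType.
Implicit Types A B : set T.

Definition mult_closed A B :=
  forall b b' : T, B b -> B b' -> b != 0 -> b' != 0 -> A (b * b') -> A b /\ A b'.

Definition divides_in A (p x : T) := exists2 q, A q & x = p * q.

Definition unit_in A (u : T) := A u /\ divides_in A u 1.

Definition prime_in A (p : T) :=
  [/\ A p, p != 0, ~ unit_in A p &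
      forall x y, A x -> A y -> divides_in A p (x * y) ->
        divides_in A p x \/ divides_in A p y].

End Subrings.

Lemma det3 (S : comNzRingType) (A : 'M[S]_3) : \det A =
  A 0 0 * (A 1 1 * A 2%:R 2%:R - A 1 2%:R * A 2%:R 1)
  - A 0 1 * (A 1 0 * A 2%:R 2%:R - A 1 2%:R * A 2%:R 0)
  + A 0 2%:R * (A 1 0 * A 2%:R 1 - A 1 1 * A 2%:R 0).
Proof.
pose B m n := A (inord m) (inord n).
have L i j : A i j = B i j by rewrite /B !inord_val.
rewrite (expand_det_row _ 0) !big_ord_recl big_ord0 /cofactor.
do 3 rewrite (expand_det_row _ 0) !big_ord_recl big_ord0 /cofactor !det_mx11 !mxE.
rewrite !{}L /= /bump /=; move: B => B; ring.
Qed.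

Section ProjectiveSpace.
Variable K : fieldType.

(* P^n(K) is the set of lines through the origin of K^(n+1). *)
Definition proj n := {l : {vspace 'rV[K]_n.+1} | \dim l == 1%N}.

(* One choice of homogeneous coordinates of x: a non-zero vector of the line x.
   It is only used in expressions that do not depend on the choice. *)
Definition hcoord n (x : proj n) : 'rV[K]_n.+1 := vpick (val x).

Definition peval n (p : {mpoly K[n]}) (v : 'rV[K]_n) : K := p.@[v 0].

Definition grad n (p : {mpoly K[n]}) (v : 'rV[K]_n) : 'rV[K]_n :=
  \row_i peval p^`M(i) v.

Definition hess n (p : {mpoly K[n]}) (v : 'rV[K]_n) : 'M[K]_n :=
  \matrix_(i, j) peval p^`M(i)^`M(j) v.

(* For p homogeneous. *)
Definition curve (p : {mpoly K[3]}) : set (proj 2) :=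
  [set x | peval p (hcoord x) = 0].

(* P^2 x P^1 with its Zariski topology: the first three variables are the
   coordinates of P^2, the last two those of P^1. *)
Notation P2P1 := (proj 2 * proj 1)%type.

Definition bihomog (d e : nat) (p : {mpoly K[3 + 2]}) : Prop :=
  forall m, m \in msupp p ->
    (\sum_(i < 3) m (lshift 2 i) = d)%N /\ (\sum_(j < 2) m (rshift 3 j) = e)%N.

Definition bieval (p : {mpoly K[3 + 2]}) (z : P2P1) : K :=
  peval p (row_mx (hcoord z.1) (hcoord z.2)).

Definition zclosure (Z : set P2P1) : set P2P1 :=
  [set z | forall d e (p : {mpoly K[3 + 2]}), bihomog d e p ->
     (forall t, Z t -> bieval p t = 0) -> bieval p z = 0].

Definition zopen (U : set P2P1) := zclosure (~` U) `<=` ~` U.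

Definition regular (S : set P2P1) (f : S -> K) : Prop :=
  forall s : S, exists U : set P2P1, exists d e (g h : {mpoly K[3 + 2]}),
    [/\ zopen U, U (val s), bihomog d e g, bihomog d e h &
        forall t : S, U (val t) ->
          bieval h (val t) != 0 /\ f t = bieval g (val t) / bieval h (val t)].

End ProjectiveSpace.

Section Kulikov.
Variable K : fieldType.
Notation P2P1 := (proj K 2 * proj K 1)%type.

Definition basept : 'rV[K]_3 := const_mx 1.

Definition is_basept (x : proj K 2) : Prop := val x = <[basept]>%VS.

Definition Qconic (i : 'I_3) : {mpoly K[3]} :=
  3%:R *: 'X_i ^+ 2 - \sum_(j < 3) \sum_(k < 3 | (j < k)%N) 'X_j * 'X_k.

Definition Rcubic : {mpoly K[3]} :=
  \sum_(i < 3) \sum_(j < 3 | j != i) 'X_i ^+ 2 * 'X_j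
    - 6%:R *: \prod_(i < 3) 'X_i.

(* Rcubic is an equation of the ramification locus of (Q1 : Q2 : Q3). *)
Lemma det_jacobian_Qconic :
  \det (\matrix_(i, j) (Qconic i)^`M(j)) = (- 36%:R) *: Rcubic.
Proof.
have dX (i j : 'I_3) : ('X_j : {mpoly K[3]})^`M(i) = (j == i)%:R.
  rewrite mderivX mnm1E; case: eqP => [->|_] /=; last by rewrite scale0r.
  have -> : (U_(i) - U_(i))%MM = 0%MM :> 'X_{1..3}.
    by apply/mnmP => k; rewrite mnmBE mnm0E subnn.
  by rewrite mpolyX0 scale1r.
have dQ i j : (Qconic i)^`M(j) =
    6%:R * (i == j)%:R * 'X_i - (\sum_(k < 3 | k != j) 'X_k).
  rewrite /Qconic mderivB mderivZ expr2 mderivM !dX -mulr_algl; congr (_ - _).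
    by rewrite scaler_nat; ring.
  rewrite [RHS]big_mkcond !raddf_sum /=.
  under eq_bigr do rewrite big_mkcond raddf_sum /=.
  under eq_bigr do under eq_bigr do rewrite fun_if mderivM !dX mderiv0.
  case: j => [[|[|[|//]]] hj]; rewrite !big_ord_recl !big_ord0 /= /bump /=
    ?mulr0 ?addr0 ?mul0r ?mul1r ?mulr1 ?add0r //; ring.
rewrite det3 !mxE !dQ /Rcubic -mulr_algl -[6%:R *: _]mulr_algl !scaler_nat.
rewrite scaleNr scaler_nat.
under [in RHS]eq_bigr do rewrite big_mkcond.
under eq_bigr do rewrite big_mkcond.
rewrite !(big_mkcond (fun k : 'I_3 => k != _)) /=.
pose X m : {mpoly K[3]} := 'X_(inord m).
have L (i : 'I_3) : 'X_i = X i by rewrite /X inord_val.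
rewrite !big_ord_recl !big_ord0 !L /= /bump /=.
move: X {L} => X.
ring.
Qed.

Definition Cconic (a : 'rV[K]_3) : {mpoly K[3]} := \sum_i a 0 i *: Qconic i.

(* Transversality of the curves p = 0 and q = 0 at a common point v where both
   are smooth. *)
Definition transverse (p q : {mpoly K[3]}) (v : 'rV[K]_3) :=
  row_free (col_mx (grad p v) (grad q v)).

(* Transversality of q = 0 to both branches of p = 0 at a node v of p: q is
   smooth at v and its tangent line there is not in the tangent cone of p, the
   zero locus of the quadratic form hess p v (which has v in its radical). *)
Definition transverse_node (p q : {mpoly K[3]}) (v : 'rV[K]_3) :=
  grad q v != 0 /\
  forall t : 'rV[K]_3, t \notin <[v]>%VS ->
    grad q v *m t^T = 0 -> t *m hess p v *m t^T != 0.

(* The genericity required of Q = a1 Q1 + a2 Q2 + a3 Q3: the conic C meets R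
   transversely at each of their common points. *)
Definition generic_conic (a : 'rV[K]_3) : Prop :=
  transverse_node Rcubic (Cconic a) basept /\
  forall x : proj K 2, ~ is_basept x -> curve Rcubic x -> curve (Cconic a) x ->
    transverse Rcubic (Cconic a) (hcoord x).

(* Blowing-up of P = (1 : 1 : 1), where X1 - X3 = X2 - X3 = 0: the closure of
   the graph of x |-> (X1 - X3 : X2 - X3). The map sigma is the first
   projection. *)
Definition blowup : set P2P1 :=
  [set z | let x := hcoord z.1 in let w := hcoord z.2 in
     (x 0 0 - x 0 2%:R) * w 0 1 = (x 0 1 - x 0 2%:R) * w 0 0].

Definition strict_transform (Z : set (proj K 2)) : set P2P1 :=
  zclosure [set z | [/\ blowup z, Z z.1 & ~ is_basept z.1]].

Definition kulikov_surface (a : 'rV[K]_3) : set P2P1 :=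
  blowup `\` (strict_transform (curve Rcubic)
              `|` strict_transform (curve (Cconic a))).

(* Homogeneous coordinates of the image of z under the extension of
   (Q1 : Q2 : Q3) o sigma to the blowing-up. The point (P, (w1 : w2)) of E is
   the direction at P of the line through (1, 1, 1) and (w1, w2, 0); since the
   Qi vanish at P, the extension sends it to the image of (w1, w2, 0) under the
   differential of (Q1, Q2, Q3) at (1, 1, 1). *)
Definition kulikov_lift (z : P2P1) : 'rV[K]_3 :=
  if `[< is_basept z.1 >] then
    \row_i (grad (Qconic i) basept *m (row_mx (hcoord z.2) (0 : 'rV_1))^T) 0 0
  else \row_i peval (Qconic i) (hcoord z.1).

(* The complement of the line L : a1 Y1 + a2 Y2 + a3 Y3 = 0 is identified with
   K^2 by (l1 / L, l2 / L), where l1, l2 are the linear forms given by the rows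
   of M; this is an isomorphism when a, l1, l2 are linearly independent. *)
Definition affine_coords (a : 'rV[K]_3) (M : 'M[K]_(2, 3)) (y : 'rV[K]_3) :
  'rV[K]_2 := ((y *m a^T) 0 0)^-1 *: (y *m M^T).

Definition kulikov_map a M (s : kulikov_surface a) : 'rV[K]_2 :=
  affine_coords a M (kulikov_lift (val s)).

Definition kulikov_comorph a M (p : {mpoly K[2]}) : kulikov_surface a -> K :=
  fun s => peval p (kulikov_map M s).

Definition kulikov_B a : set (kulikov_surface a -> K) :=
  [set f | regular f].

Definition kulikov_A a M : set (kulikov_surface a -> K) :=
  range (@kulikov_comorph a M).

End Kulikov.

(* Main.v *)
Require Import Defs.
From HB Require Import structures.
From mathcomp Require Import all_boot all_order all_algebra.
From mathcomp Require Import boolp classical_sets functions reals.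
From mathcomp Require Import complex.
From mathcomp Require Import freeg mpoly.
From mathcomp Require Import ring.

Set Implicit Arguments.
Unset Strict Implicit.
Unset Printing Implicit Defensive.

Import GRing.Theory Num.Theory.
Local Open Scope ring_scope.
Local Open Scope classical_set_scope.

(** The conic Q1 - Q2 = 3 (X1 - X2) (X1 + X2) is a pair of lines, so the line
Y1 = Y2 of the target pulls back to a reducible curve of S. On the blowing-up,
with h the class of a line and e the class of E, the strict transforms R~ and
C~ have classes 3h - 2e and 2h - e. These classes form a basis of the Picard
group, so the two components of the pulled back line, of classes h - e and h,
are principal on S:
  h - e = (3h - 2e) - (2h - e)   and   h = 2 (2h - e) - (3h - 2e)
lead to the regular functions
  f1 = 3 (X1 - X2) Q / R   and   f2 = (X1 + X2) R / Q^2,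
whose product is p = (Q1 - Q2) / Q, the image of the linear polynomial that
defines the line Y1 = Y2 in the affine plane. Neither f1 nor f2 is a multiple
of p, because each is non-zero somewhere on the zero set of p
([split_line_ndvd_factors]). Hence p is not prime in B; but it is prime in A
([split_line_prime_in_A]), so that A is not multiplicatively closed either.

To see that f1 and f2 are regular along E as well, a point of the blowing-up
is written (s P + l (w, 0), w), where w is its direction and l = 0 on E. In
these terms
  R = l^2 (s alphaR(w) + l betaR(w))   and   Q = l (s alphaC(w) + l betaC(w)),
and the factors in parentheses come from bihomogeneous polynomials Rhat and
Chat of bidegrees (1, 2) and (1, 1). Therefore f1 = 3 (w1 - w2) Chat / Rhat and
f2 = (X1 + X2) Rhat / Chat^2 globally, and it remains to see that Rhat and Chat
have no zero on S, i.e. that they cut out exactly the strict transforms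
([strict_transformP]). Above P this says that a tangent direction of the curve
is a limit of points of the curve: by the expansion above, the line through P
with direction t meets the curve again at beta(t) P - alpha(t) t, and a form
that vanishes on this parametrised curve vanishes at its limit points. For C
this needs that alphaC and betaC have no common zero, i.e. that C does not
contain a line through P. Genericity gives it: a singular point of a member of
the linear system of the Q_i is a zero of their Jacobian determinant, hence is
on R, where C is required to be smooth.

For the primality in A, every element of A is a multiple of p plus a polynomial
in one coordinate of the line Y1 = Y2 ([division_by_split_line]), and the image
of F_S contains all but finitely many points of this line. If p divides a
product, the product of the two univariate remainders thus vanishes, so that
one of them is zero.

Evaluations only have to avoid finitely many values, and the rational points
that occur are explicit, so the argument needs no algebraic closure: it is
carried out over any numFieldType. *)

(** * Vectors in dimensions 2 and 3, and polynomial identities *)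

Section Vectors.
Variable K : numFieldType.

Lemma sum_ord2 (V : nmodType) (F : 'I_2 -> V) : \sum_i F i = F 0 + F 1.
Proof.
by rewrite !big_ord_recl big_ord0 addr0; congr (_ + F _); apply: val_inj.
Qed.

Lemma sum_ord3 (V : nmodType) (F : 'I_3 -> V) :
  \sum_i F i = F 0 + F 1 + F 2%:R.
Proof.
rewrite !big_ord_recl big_ord0 addr0 addrA.
by congr (_ + F _ + F _); apply: val_inj.
Qed.

Lemma ord2P (i : 'I_2) : i = 0 \/ i = 1.
Proof. by case: i => [[|[|//]] h]; [left|right]; apply: val_inj. Qed.

Lemma ord3P (i : 'I_3) : [\/ i = 0, i = 1 | i = 2%:R].
Proof.
by case: i => [[|[|[|//]]] h]; [apply: Or31|apply: Or32|apply: Or33];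
  apply: val_inj.
Qed.

Lemma rowP2 (v w : 'rV[K]_2) : v 0 0 = w 0 0 -> v 0 1 = w 0 1 -> v = w.
Proof. by move=> h0 h1; apply/rowP => i; case: (ord2P i) => ->. Qed.

Lemma rowP3 (v w : 'rV[K]_3) :
  v 0 0 = w 0 0 -> v 0 1 = w 0 1 -> v 0 2%:R = w 0 2%:R -> v = w.
Proof. by move=> h0 h1 h2; apply/rowP => i; case: (ord3P i) => ->. Qed.

Definition vec2 (p q : K) : 'rV[K]_2 := \row_i [:: p; q]`_i.
Definition vec3 (p q r : K) : 'rV[K]_3 := \row_i [:: p; q; r]`_i.

Lemma vec2E p q : (vec2 p q 0 0 = p) * (vec2 p q 0 1 = q).
Proof. by rewrite !mxE. Qed.

Lemma vec3E p q r :
  (vec3 p q r 0 0 = p) * (vec3 p q r 0 1 = q) * (vec3 p q r 0 2%:R = r).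
Proof. by rewrite !mxE. Qed.

Definition direction (w : 'rV[K]_2) : 'rV[K]_3 := vec3 (w 0 0) (w 0 1) 0.

Definition dot3 (c y : 'rV[K]_3) : K := (y *m c^T) 0 0.

Lemma dot3E c y :
  dot3 c y = c 0 0 * y 0 0 + c 0 1 * y 0 1 + c 0 2%:R * y 0 2%:R.
Proof. by rewrite /dot3 mxE sum_ord3 !mxE; ring. Qed.

Lemma poly_neq0_ex (f : {poly K}) : f != 0 -> exists t, f.[t] != 0.
Proof.
move=> f0; apply: contrapT => /forallNP h.
have := max_poly_roots (rs := [seq n%:R | n <- iota 0 (size f)]) f0.
rewrite size_map size_iota ltnn => H; suff: false by []; apply: H.
  by apply/allP => x _; rewrite /root; apply: contraTT isT => /h.
by rewrite map_inj_uniq ?iota_uniq // => i j /eqP; rewrite eqr_nat => /eqP.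
Qed.

(** Density of the complement of finitely many points, used wherever a formula
has exceptional parameters. *)
Lemma poly_eq0_off (f g : {poly K}) :
  g != 0 -> (forall t, g.[t] != 0 -> f.[t] = 0) -> f = 0.
Proof.
move=> g0 fE; apply: contrapT => /eqP f0.
have [t] := poly_neq0_ex (mulf_neq0 f0 g0).
by rewrite hornerM mulf_eq0 negb_or => /andP[ft /fE]; apply/eqP.
Qed.

End Vectors.

Section Restriction.
Variables (K : numFieldType) (n : nat).

Lemma pevalD (p q : {mpoly K[n]}) v : peval (p + q) v = peval p v + peval q v.
Proof. exact: mevalD. Qed.

Lemma pevalB (p q : {mpoly K[n]}) v : peval (p - q) v = peval p v - peval q v.
Proof. exact: mevalB. Qed.

Lemma pevalM (p q : {mpoly K[n]}) v : peval (p * q) v = peval p v * peval q v.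
Proof. exact: mevalM. Qed.

Definition restrict (h : 'I_n -> {poly K}) (p : {mpoly K[n]}) : {poly K} :=
  mmap polyC h p.

Lemma horner_restrict (h : 'I_n -> {poly K}) p t (v : 'rV[K]_n) :
  (forall i, v 0 i = (h i).[t]) -> (restrict h p).[t] = peval p v.
Proof.
move=> vE; rewrite /restrict /mmap horner_sum /peval mevalE.
apply: eq_bigr => m _; rewrite hornerM hornerC /mmap1 -horner_evalE rmorph_prod.
by congr (_ * _); apply: eq_bigr => i _; rewrite rmorphXn /= horner_evalE vE.
Qed.

Lemma restrictD (h : 'I_n -> {poly K}) p q :
  restrict h (p + q) = restrict h p + restrict h q.
Proof. exact: rmorphD. Qed.

Lemma restrictM (h : 'I_n -> {poly K}) p q :
  restrict h (p * q) = restrict h p * restrict h q.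
Proof. exact: rmorphM. Qed.

Lemma restrictC (h : 'I_n -> {poly K}) c : restrict h c%:MP = c%:P.
Proof. exact: mmapC. Qed.

Lemma restrictX (h : 'I_n -> {poly K}) i : restrict h 'X_i = h i.
Proof. by rewrite /restrict mmapX mmap1U. Qed.

End Restriction.

(** * Bihomogeneous polynomials *)

Section Bihomogeneous.
Variable K : numFieldType.
Implicit Types (p q : {mpoly K[3 + 2]}) (x : 'rV[K]_3) (w : 'rV[K]_2).

Lemma bihomog_const c : bihomog 0 0 (c%:MP : {mpoly K[3 + 2]}).
Proof.
move=> m; rewrite msuppC; case: eqP => // _; rewrite inE => /eqP ->.
by split; rewrite big1 // => i _; rewrite mnm0E.
Qed.

Lemma bihomogD d e p q : bihomog d e p -> bihomog d e q -> bihomog d e (p + q).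
Proof. by move=> hp hq m /msuppD_le; rewrite mem_cat => /orP[/hp|/hq]. Qed.

Lemma bihomogM d e d' e' p q : bihomog d e p -> bihomog d' e' q ->
  bihomog (d + d') (e + e') (p * q).
Proof.
move=> hp hq m /msuppM_le /allpairsP[[m1 m2] /= [/hp[a1 a2] /hq[b1 b2] ->]].
by split; under eq_bigr do rewrite mnmDE; rewrite big_split /=; congr (_ + _)%N.
Qed.

Lemma bihomogZ d e c p : bihomog d e p -> bihomog d e (c *: p).
Proof. by move=> hp m /msuppZ_le /hp. Qed.

Lemma bihomogN d e p : bihomog d e p -> bihomog d e (- p).
Proof. by rewrite -scaleN1r; apply: bihomogZ. Qed.

Lemma bihomogB d e p q : bihomog d e p -> bihomog d e q -> bihomog d e (p - q).
Proof. by move=> hp hq; apply: bihomogD => //; apply: bihomogN. Qed.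

Definition xvar i : {mpoly K[3 + 2]} := 'X_(lshift 2 i).
Definition wvar j : {mpoly K[3 + 2]} := 'X_(rshift 3 j).

Lemma bihomog_xvar i : bihomog 1 0 (xvar i).
Proof.
move=> m; rewrite msuppX inE => /eqP ->; split.
  rewrite (bigD1 i) //= mnm1E eqxx big1 // => k ki.
  by rewrite mnm1E (inj_eq (@lshift_inj _ _)) eq_sym (negbTE ki).
by rewrite big1 // => k _; rewrite mnm1E eq_lrshift.
Qed.

Lemma bihomog_wvar j : bihomog 0 1 (wvar j).
Proof.
move=> m; rewrite msuppX inE => /eqP ->; split; last first.
  rewrite (bigD1 j) //= mnm1E eqxx big1 // => k ki.
  by rewrite mnm1E (inj_eq (@rshift_inj _ _)) eq_sym (negbTE ki).
by rewrite big1 // => k _; rewrite mnm1E eq_rlshift.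
Qed.

Lemma peval_xvar i x w : peval (xvar i) (row_mx x w) = x 0 i.
Proof. by rewrite /peval mevalXU row_mxEl. Qed.

Lemma peval_wvar j x w : peval (wvar j) (row_mx x w) = w 0 j.
Proof. by rewrite /peval mevalXU row_mxEr. Qed.

Lemma bihomog_scale d e p c c' x w : bihomog d e p ->
  peval p (row_mx (c *: x) (c' *: w)) = c ^+ d * c' ^+ e * peval p (row_mx x w).
Proof.
move=> hp; rewrite /peval !mevalE mulr_sumr big_seq [RHS]big_seq.
apply: eq_bigr => m /hp[dE eE]; rewrite mulrCA; congr (_ * _).
rewrite !big_split_ord /=.
under eq_bigr do rewrite row_mxEl mxE exprMn.
under [X in _ * X]eq_bigr do rewrite row_mxEr mxE exprMn.
rewrite !big_split /= !prodrXr dE eE mulrACA; congr (_ * (_ * _)).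
  by apply: eq_bigr => i _; rewrite row_mxEl.
by apply: eq_bigr => i _; rewrite row_mxEr.
Qed.

End Bihomogeneous.

(** * Points of projective spaces *)

Section Points.
Variable K : numFieldType.

Lemma dim_proj n (x : proj K n) : \dim (val x) = 1%N.
Proof. exact/eqP/(valP x). Qed.

Lemma hcoord_neq0 n (x : proj K n) : hcoord x != 0.
Proof. by rewrite /hcoord vpick0 -dimv_eq0 dim_proj. Qed.

Lemma val_hcoord n (x : proj K n) : val x = <[hcoord x]>%VS.
Proof.
apply/eqP; rewrite eq_sym eqEdim dim_vline hcoord_neq0 dim_proj leqnn andbT.
by rewrite -memvE memv_pick.
Qed.

Lemma proj_ex n (v : 'rV[K]_n.+1) : v != 0 ->
  exists2 x : proj K n, val x = <[v]>%VS &
    exists2 c, c != 0 & hcoord x = c *: v.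
Proof.
move=> v0; have dv : \dim <[v]> == 1%N by rewrite dim_vline v0.
exists (exist _ <[v]>%VS dv) => //.
set x := exist _ _ _; have /vlineP[c cE] : hcoord x \in <[v]>%VS.
  by rewrite /hcoord memv_pick.
exists c => //; apply: contraNneq (hcoord_neq0 x) => c0.
by rewrite cE c0 scale0r.
Qed.

Section BihomogeneousEvaluation.
Variable z : proj K 2 * proj K 1.
Implicit Types p q : {mpoly K[3 + 2]}.

Lemma bievalB p q : bieval (p - q) z = bieval p z - bieval q z.
Proof. exact: mevalB. Qed.

Lemma bievalD p q : bieval (p + q) z = bieval p z + bieval q z.
Proof. exact: mevalD. Qed.

Lemma bievalM p q : bieval (p * q) z = bieval p z * bieval q z.
Proof. exact: mevalM. Qed.

Lemma bievalZ c p : bieval (c *: p) z = c * bieval p z.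
Proof. exact: mevalZ. Qed.

Lemma bieval_xvar i : bieval (xvar K i) z = hcoord z.1 0 i.
Proof. exact: peval_xvar. Qed.

Lemma bieval_wvar j : bieval (wvar K j) z = hcoord z.2 0 j.
Proof. exact: peval_wvar. Qed.

End BihomogeneousEvaluation.

End Points.

(** * The blowing-up of P and strict transforms *)

Section TangentCone.
Variable K : numFieldType.
Notation P2P1 := (proj K 2 * proj K 1)%type.
Notation basept := (basept K).

Lemma basept_neq0 : basept != 0.
Proof. by apply/eqP => /rowP/(_ 0)/eqP; rewrite !mxE oner_eq0. Qed.

Lemma is_baseptP (x : proj K 2) :
  is_basept x <-> exists k, hcoord x = k *: basept.
Proof.
split=> [xP|[k xk]].
  by apply/vlineP; rewrite -xP val_hcoord memv_line.
have k0 : k != 0.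
  by apply: contraNneq (hcoord_neq0 x) => k0; rewrite xk k0 scale0r.
rewrite /is_basept val_hcoord xk; apply/eqP.
by rewrite eqEdim !dim_vline scaler_eq0 (negbTE k0) (negbTE basept_neq0) leqnn
  andbT -memvE memvZ ?memv_line.
Qed.

(** The pencil of lines through P: when w is fixed, s and l are coordinates on
the line with direction w, and l = 0 is P. The third coordinate of the direction
is 0 because the second projection of the blowing-up is (X1 - X3 : X2 - X3). *)
Definition pencil_pt (s l : K) (w : 'rV[K]_2) : 'rV[K]_3 :=
  s *: basept + l *: direction w.

Lemma pencil_ptE s l w :
  (pencil_pt s l w 0 0 = s + l * w 0 0) *
  (pencil_pt s l w 0 1 = s + l * w 0 1) * (pencil_pt s l w 0 2%:R = s).
Proof. by rewrite !mxE /= mulr0 !mulr1 addr0. Qed.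

Lemma blowup_pencil_pt (z : P2P1) : blowup z ->
  exists s l, hcoord z.1 = pencil_pt s l (hcoord z.2).
Proof.
rewrite /blowup /=; set x := hcoord z.1; set w := hcoord z.2 => xw.
exists (x 0 2%:R); have [w0|w0] := eqVneq (w 0 0) 0; last first.
  exists ((x 0 0 - x 0 2%:R) / w 0 0).
  apply: rowP3; rewrite pencil_ptE //; first by field.
  by rewrite mulrAC xw mulfK // addrC subrK.
have w1 : w 0 1 != 0.
  apply: contraNneq (hcoord_neq0 z.2) => w1; apply/eqP.
  by apply: rowP2; rewrite -/w ?w0 ?w1 mxE.
exists ((x 0 1 - x 0 2%:R) / w 0 1).
have /eqP : (x 0 0 - x 0 2%:R) * w 0 1 = 0 by rewrite xw w0 mulr0.
rewrite mulf_eq0 (negbTE w1) orbF subr_eq0 => /eqP x02.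
by apply: rowP3; rewrite pencil_ptE // ?w0 ?x02; field.
Qed.

Lemma pencil_pt_blowup (z : P2P1) s l :
  hcoord z.1 = pencil_pt s l (hcoord z.2) -> blowup z.
Proof. by rewrite /blowup /= => ->; rewrite !pencil_ptE; ring. Qed.

Lemma is_basept_pencil_pt (z : P2P1) s l :
  hcoord z.1 = pencil_pt s l (hcoord z.2) -> (is_basept z.1 <-> l = 0).
Proof.
move=> zE; split=> [/is_baseptP[k]|l0]; last first.
  by apply/is_baseptP; exists s; rewrite zE /pencil_pt l0 scale0r addr0.
rewrite zE => kE; apply: contrapT => /eqP l0.
have E i : pencil_pt s l (hcoord z.2) 0 i = k by rewrite kE !mxE mulr1.
have sk := E 2%:R; rewrite pencil_ptE in sk.
have := hcoord_neq0 z.2; case/eqP; apply: rowP2; rewrite [RHS]mxE.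
  have /eqP := E 0; rewrite pencil_ptE sk -subr_eq0 addrC addKr mulf_eq0.
  by rewrite (negbTE l0) => /eqP.
have /eqP := E 1; rewrite pencil_ptE sk -subr_eq0 addrC addKr mulf_eq0.
by rewrite (negbTE l0) => /eqP.
Qed.

Lemma blowup_pt_ex (s l : K) (w : 'rV[K]_2) :
  w != 0 -> pencil_pt s l w != 0 ->
  exists z : P2P1, exists c c' : K, [/\ c != 0, c' != 0,
    hcoord z.1 = c *: pencil_pt s l w, hcoord z.2 = c' *: w &
    hcoord z.1 = pencil_pt (c * s) (c * l / c') (hcoord z.2)].
Proof.
move=> w0 x0; have [x _ [c c0 xE]] := proj_ex x0.
have [y _ [c' c'0 yE]] := proj_ex w0.
exists (x, y), c, c'; split => //=; rewrite xE yE.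
by apply: rowP3; rewrite [LHS]mxE !pencil_ptE ?mxE; field.
Qed.

(** A curve G = 0 with multiplicity m + 1 at P and degree m + 2. The form alpha is
its tangent cone at P, and [Ghat_expansion] says that Ghat is what remains of G
after division by the power of the equation of E. *)
Section StrictTransform.
Variables (G : {mpoly K[3]}) (m : nat) (alpha beta : {mpoly K[2]}).
Variables (d e : nat) (Ghat : {mpoly K[3 + 2]}).
Hypothesis G_expansion : forall s l w, peval G (pencil_pt s l w) =
  l ^+ m.+1 * (s * peval alpha w + l * peval beta w).
Hypothesis alpha_neq0 : exists w, peval alpha w != 0.
Hypothesis alpha_beta_coprime : forall w, w != 0 ->
  peval alpha w = 0 -> peval beta w != 0.
Hypothesis bihomog_Ghat : bihomog d e Ghat.
Hypothesis Ghat_expansion : forall s l w,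
  peval Ghat (row_mx (pencil_pt s l w) w) = s * peval alpha w + l * peval beta w.

(** The zero vector is not a direction; alpha vanishes there because the
expansion of G at (s, 1, 0) and at (s, 0, 0) concerns the same point. *)
Lemma alpha_neq0_dir w : peval alpha w != 0 -> w != 0.
Proof.
apply: contraNneq => ->.
have E s : s * peval alpha 0 + peval beta 0 = 0.
  have := G_expansion s 1 0; have := G_expansion s 0 0.
  rewrite expr0n /= mul0r expr1n !mul1r => <- <-; congr peval.
  by apply: rowP3; rewrite !pencil_ptE ?mxE ?mulr0.
by have := E 1; have := E 0; rewrite mul0r mul1r add0r => ->; rewrite addr0 => ->.
Qed.

(** The tangent directions at P belong to the strict transform. A form that
vanishes on the curve away from P is restricted to the arc
tau |-> (beta(t) P - alpha(t) t, t), where t runs over a line of directions that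
starts at w and is not contained in the tangent cone; the restriction vanishes
identically as it does so off the zeros of alpha(t), and at tau = 0 the arc is at
the given point because alpha(w) = 0. *)
Lemma strict_transform_base (z : P2P1) s : hcoord z.1 = s *: basept ->
  peval alpha (hcoord z.2) = 0 -> strict_transform (curve G) z.
Proof.
set w := hcoord z.2 => zE aw d' e' p hp pZ.
have w_neq0 : w != 0 by apply: hcoord_neq0.
have bw := alpha_beta_coprime w_neq0 aw; case: alpha_neq0 => w' aw'.
pose T j : {poly K} := (w 0 j)%:P + (w' 0 j - w 0 j)%:P * 'X.
pose t tau := w + tau *: (w' - w).
have tE tau j : t tau 0 j = (T j).[tau].
  by rewrite /T !hornerE !mxE mulrC.
pose A := restrict T alpha; pose B := restrict T beta.
have AE tau : A.[tau] = peval alpha (t tau) by apply: horner_restrict.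
have BE tau : B.[tau] = peval beta (t tau) by apply: horner_restrict.
(* The coordinates of the arc in P^2 x P^1. *)
pose h (k : 'I_(3 + 2)) : {poly K} := match fintype.split k with
  | inl i => B - A * [:: T 0; T 1; 0]`_i
  | inr j => T j end.
pose x tau := pencil_pt B.[tau] (- A.[tau]) (t tau).
have rE tau : (restrict h p).[tau] = peval p (row_mx (x tau) (t tau)).
  apply: horner_restrict => k; rewrite mxE /h.
  case: (fintype.split k) => j; last first.
    exact: tE.
  by case: (ord3P j) => ->; rewrite pencil_ptE !(hornerE, tE) //=;
    rewrite ?hornerE ?tE; ring.
have A0 : A != 0.
  apply: contraTneq aw' => A0; have := AE 1.
  by rewrite A0 horner0 /t scale1r addrC subrK => <-; rewrite eqxx.
have r0 : restrict h p = 0.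
  apply: (poly_eq0_off A0) => tau Atau.
  have t0 : t tau != 0 by apply: alpha_neq0_dir; rewrite -AE.
  have x0 : x tau != 0.
    apply: contraNneq t0 => x0; apply/eqP.
    have E i : x tau 0 i = 0 by rewrite x0 mxE.
    have := E 2%:R; rewrite pencil_ptE => B0.
    have /eqP := E 0; rewrite pencil_ptE B0 add0r mulf_eq0 oppr_eq0.
    rewrite (negbTE Atau) => /eqP t00.
    have /eqP := E 1; rewrite pencil_ptE B0 add0r mulf_eq0 oppr_eq0.
    rewrite (negbTE Atau) => /eqP t01.
    by apply: rowP2; rewrite [RHS]mxE.
  have [y [c [c' [c0 c'0 y1 y2 yE]]]] := blowup_pt_ex t0 x0.
  have : bieval p y = 0.
    apply: pZ; split; first exact: pencil_pt_blowup yE.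
      rewrite /curve /= yE G_expansion y2.
      (* The expansion of G makes alpha and beta homogeneous. *)
      have bh k : peval beta (k *: t tau) = k ^+ m.+2 * peval beta (t tau).
        have := G_expansion 0 1 (k *: t tau); have := G_expansion 0 k (t tau).
        rewrite expr1n !mul0r !add0r !mul1r mulrA -exprSr => <- <-; congr peval.
        by apply: rowP3; rewrite !pencil_ptE ?mxE ?mul1r.
      have ah k : peval alpha (k *: t tau) = k ^+ m.+1 * peval alpha (t tau).
        have := G_expansion 1 1 (k *: t tau); have := G_expansion 1 k (t tau).
        rewrite expr1n !mul1r mulrDr mulrA -exprSr -bh => E1 E2.
        apply: (addIr (peval beta (k *: t tau))); rewrite -E1 -E2; congr peval.
        by apply: rowP3; rewrite !pencil_ptE ?mxE ?mul1r.
      by rewrite ah bh AE BE !exprS; field.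
    move=> /(is_basept_pencil_pt yE) /eqP.
    by rewrite !mulf_eq0 invr_eq0 oppr_eq0 (negbTE c0) (negbTE c'0) (negbTE Atau).
  rewrite rE /bieval y1 y2 (bihomog_scale _ _ _ _ hp) => /eqP.
  by rewrite !mulf_eq0 !expf_eq0 (negbTE c0) (negbTE c'0) !andbF => /eqP.
have := rE 0; rewrite r0 horner0 /x AE BE /t scale0r addr0 aw oppr0.
have s0 : s != 0.
  by apply: contraNneq (hcoord_neq0 z.1) => s0; rewrite zE s0 scale0r.
have -> : pencil_pt (peval beta w) 0 w = (peval beta w / s) *: hcoord z.1.
  by rewrite zE scalerA divfK // /pencil_pt scale0r addr0.
rewrite -[X in row_mx _ X]scale1r (bihomog_scale _ _ _ _ hp) => /esym/eqP.
rewrite !mulf_eq0 !expf_eq0 oner_eq0 mulf_eq0 invr_eq0 (negbTE bw) (negbTE s0).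
by rewrite !andbF => /eqP.
Qed.

(** Off E the factor l^(m + 1) is invertible, so G and Ghat have the same zeros;
on E the zeros of Ghat are the tangent directions. *)
Lemma strict_transformP (z : P2P1) : blowup z ->
  strict_transform (curve G) z <-> bieval Ghat z = 0.
Proof.
move=> zb; split=> [zZ|].
  apply: (zZ _ _ _ bihomog_Ghat) => y [/blowup_pencil_pt[s [l yE]] yG yP].
  have l0 : l != 0 by apply/eqP => l0; apply: yP; apply/(is_basept_pencil_pt yE).
  move: yG; rewrite /curve /= /bieval yE G_expansion Ghat_expansion => /eqP.
  by rewrite mulf_eq0 expf_eq0 (negbTE l0) andbF => /eqP.
have [s [l zE]] := blowup_pencil_pt zb.
rewrite /bieval zE Ghat_expansion => Gz.
have [l0|l0] := eqVneq l 0.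
  move: Gz zE; rewrite l0 mul0r addr0 /pencil_pt scale0r addr0 => /eqP Gz zE.
  apply: (strict_transform_base zE); apply/eqP; move: Gz.
  rewrite mulf_eq0 orbC; case: eqP => //= _ /eqP s0.
  by move: (hcoord_neq0 z.1); rewrite zE s0 scale0r eqxx.
move=> d' e' p hp; apply; split => //; last first.
  by move/(is_basept_pencil_pt zE)/eqP; apply/negP.
by rewrite /curve /= zE G_expansion Gz mulr0.
Qed.

End StrictTransform.
End TangentCone.

(** * Equations of the cubic and of the conics on the blowing-up *)

Section Equations.
Variable K : numFieldType.
Notation P2P1 := (proj K 2 * proj K 1)%type.
Notation basept := (basept K).
Implicit Types (a x y : 'rV[K]_3) (w : 'rV[K]_2).

Lemma peval_Qconic i x : peval (Qconic K i) x =
  3%:R * x 0 i ^+ 2 - (x 0 0 * x 0 1 + x 0 0 * x 0 2%:R + x 0 1 * x 0 2%:R).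
Proof.
rewrite /peval /Qconic; under eq_bigr do rewrite big_mkcond.
rewrite !sum_ord3 /= !(mevalB, mevalD, mevalM, mevalZ, rmorphXn, mevalXU) /=.
by rewrite !rmorph0; ring.
Qed.

Lemma peval_Rcubic x : peval (Rcubic K) x =
  x 0 0 ^+ 2 * x 0 1 + x 0 0 ^+ 2 * x 0 2%:R + x 0 1 ^+ 2 * x 0 0
  + x 0 1 ^+ 2 * x 0 2%:R + x 0 2%:R ^+ 2 * x 0 0 + x 0 2%:R ^+ 2 * x 0 1
  - 6%:R * (x 0 0 * x 0 1 * x 0 2%:R).
Proof.
rewrite /peval /Rcubic; under eq_bigr do rewrite big_mkcond.
have -> : \prod_(i < 3) 'X_i = 'X_0 * 'X_1 * 'X_(2%:R) :> {mpoly K[3]}.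
  rewrite !big_ord_recl big_ord0 mulr1 mulrA.
  by congr (_ * 'X__ * 'X__); apply: val_inj.
rewrite !sum_ord3 /= !(mevalB, mevalD, mevalM, mevalZ, rmorphXn, mevalXU) /=.
by rewrite !rmorph0; ring.
Qed.

Lemma peval_Cconic a x :
  peval (Cconic a) x = dot3 a (\row_i peval (Qconic K i) x).
Proof. by rewrite dot3E /peval /Cconic sum_ord3 !mevalD !mevalZ !mxE. Qed.

Lemma grad_Qconic i x j : grad (Qconic K i) x 0 j =
  6%:R * (i == j)%:R * x 0 i - (x 0 0 + x 0 1 + x 0 2%:R - x 0 j).
Proof.
have dX (k l : 'I_3) : ('X_l : {mpoly K[3]})^`M(k) = (l == k)%:R.
  rewrite mderivX mnm1E; case: eqP => [->|_] /=; last by rewrite scale0r.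
  have -> : (U_(k) - U_(k))%MM = 0%MM :> 'X_{1..3}.
    by apply/mnmP => i'; rewrite mnmBE mnm0E subnn.
  by rewrite mpolyX0 scale1r.
rewrite mxE /Qconic mderivB mderivZ expr2 mderivM !dX.
under eq_bigr do rewrite big_mkcond.
rewrite !sum_ord3 /= !(mderivD, mderivM, mderiv0, raddf0) !dX /peval.
rewrite !(mevalB, mevalD, mevalM, mevalZ, mevalXU, rmorph_nat, rmorph0).
by case: (ord3P j) => ->; case: (ord3P i) => ->; rewrite /=; ring.
Qed.

Lemma grad_Cconic a x : grad (Cconic a) x = \sum_i a 0 i *: grad (Qconic K i) x.
Proof.
apply/rowP => j; rewrite summxE !mxE /Cconic raddf_sum /peval raddf_sum.
by apply: eq_bigr => i _; rewrite !mxE /= mderivZ mevalZ.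
Qed.

Lemma grad_CconicE a x j : grad (Cconic a) x 0 j = 6%:R * a 0 j * x 0 j
  - (a 0 0 + a 0 1 + a 0 2%:R) * (x 0 0 + x 0 1 + x 0 2%:R - x 0 j).
Proof.
rewrite grad_Cconic summxE sum_ord3.
rewrite !(mxE scalemx_key) -/(grad _ _) !grad_Qconic.
by case: (ord3P j) => ->; rewrite /=; ring.
Qed.

(** Euler's identity, which puts a singular point of the conic on the conic. *)
Lemma Cconic_euler a x :
  2%:R * peval (Cconic a) x = dot3 x (grad (Cconic a) x).
Proof.
by rewrite peval_Cconic !dot3E !grad_CconicE !mxE !peval_Qconic; ring.
Qed.

(** The lowest and the highest terms in l of the expansions at P of the cubic
(alphaR, betaR), of the conics Q_i (alphaQ, betaQ), and of C (alphaC, betaC);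
see [Rcubic_expansion] and [Cconic_expansion]. *)
Definition alphaR : {mpoly K[2]} :=
  2%:R *: ('X_0 * 'X_0 - 'X_0 * 'X_1 + 'X_1 * 'X_1).
Definition betaR : {mpoly K[2]} := 'X_0 * 'X_1 * ('X_0 + 'X_1).

Definition dirvar (T : nzRingType) (w : 'I_2 -> T) (i : 'I_3) : T :=
  [:: w 0; w 1; 0]`_i.

Definition alphaQ i : {mpoly K[2]} :=
  6%:R *: dirvar (fun j => 'X_j) i - 2%:R *: ('X_0 + 'X_1).
Definition betaQ i : {mpoly K[2]} :=
  3%:R *: (dirvar (fun j => 'X_j) i * dirvar (fun j => 'X_j) i) - 'X_0 * 'X_1.
Definition alphaC a := \sum_i a 0 i *: alphaQ i.
Definition betaC a := \sum_i a 0 i *: betaQ i.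

(** The bihomogeneous forms of s alpha(w) + l beta(w): with s = X3 and
l w = (X1 - X3, X2 - X3), one factor w of each monomial of beta is replaced by
the corresponding difference, which absorbs l. *)
Definition Rhat : {mpoly K[3 + 2]} :=
  xvar K 2%:R * (2%:R *: (wvar K 0 * wvar K 0 - wvar K 0 * wvar K 1
                        + wvar K 1 * wvar K 1))
  + (xvar K 0 - xvar K 2%:R) * (wvar K 1 * (wvar K 0 + wvar K 1)).

Definition Qhat i : {mpoly K[3 + 2]} :=
  xvar K 2%:R * (6%:R *: dirvar (wvar K) i - 2%:R *: (wvar K 0 + wvar K 1))
  + (3%:R *: ((xvar K i - xvar K 2%:R) * dirvar (wvar K) i)
     - (xvar K 0 - xvar K 2%:R) * wvar K 1).

Definition Chat a := \sum_i a 0 i *: Qhat i.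

Lemma peval_alphaR w : peval alphaR w =
  2%:R * (w 0 0 ^+ 2 - w 0 0 * w 0 1 + w 0 1 ^+ 2).
Proof.
by rewrite /peval !(mevalB, mevalD, mevalM, mevalZ, mevalXU); ring.
Qed.

Lemma peval_betaR w : peval betaR w = w 0 0 * w 0 1 * (w 0 0 + w 0 1).
Proof. by rewrite /peval !(mevalD, mevalM, mevalXU). Qed.

Lemma peval_dirvar i w :
  peval (dirvar (fun j => 'X_j) i) w = direction w 0 i.
Proof.
rewrite mxE /dirvar /peval.
by case: (ord3P i) => -> /=; rewrite ?mevalXU // rmorph0.
Qed.

Lemma peval_alphaQ i w : peval (alphaQ i) w =
  6%:R * direction w 0 i - 2%:R * (w 0 0 + w 0 1).
Proof.
by rewrite -peval_dirvar /peval !(mevalB, mevalD, mevalM, mevalZ, mevalXU).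
Qed.

Lemma peval_betaQ i w : peval (betaQ i) w =
  3%:R * direction w 0 i ^+ 2 - w 0 0 * w 0 1.
Proof.
by rewrite -peval_dirvar /peval !(mevalB, mevalD, mevalM, mevalZ, mevalXU) expr2.
Qed.

Lemma peval_lincomb n (c : 'I_3 -> K) (f : 'I_3 -> {mpoly K[n]}) v :
  peval (\sum_i c i *: f i) v = \sum_i c i * peval (f i) v.
Proof. by rewrite /peval raddf_sum; apply: eq_bigr => i _; rewrite /= mevalZ. Qed.

Lemma Rcubic_expansion s l w : peval (Rcubic K) (pencil_pt s l w) =
  l ^+ 2 * (s * peval alphaR w + l * peval betaR w).
Proof. by rewrite peval_Rcubic peval_alphaR peval_betaR !pencil_ptE; ring. Qed.

Lemma Qconic_expansion i s l w : peval (Qconic K i) (pencil_pt s l w) =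
  l ^+ 1 * (s * peval (alphaQ i) w + l * peval (betaQ i) w).
Proof.
rewrite peval_Qconic peval_alphaQ peval_betaQ !pencil_ptE.
by case: (ord3P i) => ->; rewrite !pencil_ptE !vec3E; ring.
Qed.

Lemma Cconic_expansion a s l w : peval (Cconic a) (pencil_pt s l w) =
  l ^+ 1 * (s * peval (alphaC a) w + l * peval (betaC a) w).
Proof.
rewrite !peval_lincomb !sum_ord3 !Qconic_expansion; ring.
Qed.

Lemma peval_Rhat x w : peval Rhat (row_mx x w) =
  x 0 2%:R * (2%:R * (w 0 0 ^+ 2 - w 0 0 * w 0 1 + w 0 1 ^+ 2))
  + (x 0 0 - x 0 2%:R) * (w 0 1 * (w 0 0 + w 0 1)).
Proof.
rewrite -(peval_wvar 0 x) -(peval_wvar 1 x).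
rewrite -(peval_xvar 0 x w) -(peval_xvar 2%:R x w) /peval.
by rewrite !(mevalB, mevalD, mevalM, mevalZ); ring.
Qed.

Lemma peval_Qhat i x w : peval (Qhat i) (row_mx x w) =
  x 0 2%:R * (6%:R * direction w 0 i - 2%:R * (w 0 0 + w 0 1))
  + (3%:R * ((x 0 i - x 0 2%:R) * direction w 0 i)
     - (x 0 0 - x 0 2%:R) * w 0 1).
Proof.
have <- : peval (dirvar (wvar K) i) (row_mx x w) = direction w 0 i.
  rewrite mxE /dirvar; case: (ord3P i) => -> /=; rewrite ?peval_wvar //.
  by rewrite /peval rmorph0.
rewrite -(peval_wvar 0 x) -(peval_wvar 1 x).
rewrite -(peval_xvar 0 x w) -(peval_xvar 2%:R x w) -(peval_xvar i x w) /peval.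
by rewrite !(mevalB, mevalD, mevalM, mevalZ); ring.
Qed.

Lemma Rhat_expansion s l w : peval Rhat (row_mx (pencil_pt s l w) w) =
  s * peval alphaR w + l * peval betaR w.
Proof. by rewrite peval_Rhat peval_alphaR peval_betaR !pencil_ptE; ring. Qed.

Lemma Qhat_expansion i s l w : peval (Qhat i) (row_mx (pencil_pt s l w) w) =
  s * peval (alphaQ i) w + l * peval (betaQ i) w.
Proof.
rewrite peval_Qhat peval_alphaQ peval_betaQ !pencil_ptE.
by case: (ord3P i) => ->; rewrite !pencil_ptE !vec3E; ring.
Qed.

Lemma Chat_expansion a s l w : peval (Chat a) (row_mx (pencil_pt s l w) w) =
  s * peval (alphaC a) w + l * peval (betaC a) w.
Proof. by rewrite !peval_lincomb !sum_ord3 !Qhat_expansion; ring. Qed.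

Lemma bihomog_dirvar i : bihomog 0 1 (dirvar (wvar K) i).
Proof.
rewrite /dirvar; case: (ord3P i) => -> /=; try exact: bihomog_wvar.
by move=> m; rewrite msupp0.
Qed.

Lemma bihomog_Rhat : bihomog 1 2 Rhat.
Proof.
have W j k : bihomog 0 2 (wvar K j * wvar K k).
  by apply: (@bihomogM _ 0 1 0 1); apply: bihomog_wvar.
apply: bihomogD; apply: (@bihomogM _ 1 0 0 2).
- exact: bihomog_xvar.
- by apply/bihomogZ/bihomogD => //; apply: bihomogB.
- by apply: bihomogB; apply: bihomog_xvar.
- by rewrite mulrDr; apply: bihomogD.
Qed.

Lemma bihomog_Qhat i : bihomog 1 1 (Qhat i).
Proof.
have W := @bihomog_wvar K; have X := @bihomog_xvar K; have D := @bihomog_dirvar.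
apply: bihomogD; last apply: bihomogB; last 2 first.
- by apply: bihomogZ; apply: (@bihomogM _ 1 0 0 1) => //; apply: bihomogB.
- by apply: (@bihomogM _ 1 0 0 1) => //; apply: bihomogB.
apply: (@bihomogM _ 1 0 0 1) => //; apply: bihomogB; apply: bihomogZ => //.
exact: bihomogD.
Qed.

Lemma bihomog_Chat a : bihomog 1 1 (Chat a).
Proof.
have H i : bihomog 1 1 (a 0 i *: Qhat i) by apply/bihomogZ/bihomog_Qhat.
by rewrite /Chat sum_ord3; apply: bihomogD => //; apply: bihomogD.
Qed.

Lemma alphaR_neq0 : exists w, peval alphaR w != 0.
Proof.
exists (vec2 1 0); rewrite peval_alphaR !vec2E.
by rewrite expr1n mulr0 expr0n /= subr0 addr0 mulr1 pnatr_eq0.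
Qed.

(** The nodal cubic contains no line through its node. *)
Lemma alphaR_betaR_coprime w : w != 0 ->
  peval alphaR w = 0 -> peval betaR w != 0.
Proof.
rewrite peval_alphaR peval_betaR => w0 /eqP; rewrite mulf_eq0 pnatr_eq0 /=.
move=> /eqP aw; apply: contraNneq w0 => /eqP; rewrite !mulf_eq0 => bw.
suff [w00 w01] : w 0 0 = 0 /\ w 0 1 = 0 by apply/eqP/rowP2; rewrite mxE.
have sq0 (u : K) : u ^+ 2 = 0 -> u = 0 by move/eqP; rewrite expf_eq0 => /eqP.
case/orP: bw => [/orP[]|] /eqP w00.
- split=> //; apply: sq0; rewrite -aw w00; ring.
- split=> //; apply: sq0; rewrite -aw w00; ring.
have w01 : w 0 1 = 0.
  have : 3%:R * w 0 1 ^+ 2 = 0.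
    have E : w 0 0 = - w 0 1 by apply/eqP; rewrite -addr_eq0 w00.
    by rewrite -aw E; ring.
  by move/eqP; rewrite mulf_eq0 pnatr_eq0 => /eqP/sq0.
by move: w00; rewrite w01 addr0.
Qed.

End Equations.

(** * Smoothness of the generic conic, and equations of the surface *)

Section GenericConic.
Variables (K : numFieldType) (a : 'rV[K]_3).
Hypothesis generic_a : generic_conic a.
Notation basept := (basept K).
Notation P2P1 := (proj K 2 * proj K 1)%type.

Lemma generic_neq0 : a != 0.
Proof.
have [[gP _] _] := generic_a; apply: contraNneq gP => ->.
by apply/eqP/rowP => j; rewrite grad_CconicE !mxE; ring.
Qed.

(** The generic conic is smooth: at a singular point v the combination a of the
gradients of the Q_i vanishes, so their Jacobian determinant does too and v is
on R; but C is smooth at its common points with R. *)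
Lemma generic_smooth v : v != 0 -> grad (Cconic a) v != 0.
Proof.
move=> v0; apply/eqP => gv.
have gZ c : grad (Cconic a) (c *: v) = 0.
  apply/rowP => j; move/rowP/(_ j): gv; rewrite !grad_CconicE !mxE => gj.
  by rewrite -[RHS](mulr0 c) -gj; ring.
have [x _ [c c0 xE]] := proj_ex v0.
have [[gP _] transv] := generic_a.
have xP : ~ is_basept x.
  move/is_baseptP => [k kE]; move: (gZ (k^-1 * c)); rewrite -scalerA -xE kE.
  rewrite scalerK ?(eqP gP) //; first by move/eqP; apply/negP.
  by apply: contraNneq (hcoord_neq0 x) => k0; rewrite kE k0 scale0r.
have gx : grad (Cconic a) (hcoord x) = 0 by rewrite xE.
have Cx : curve (Cconic a) x.
  rewrite /curve /=; suff : 2%:R * peval (Cconic a) (hcoord x) = 0.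
    by move/eqP; rewrite mulf_eq0 pnatr_eq0 => /eqP.
  by rewrite Cconic_euler gx dot3E !mxE !mulr0 !addr0.
have Rx : curve (Rcubic K) x.
  have : \det (\matrix_(i, j) grad (Qconic K i) (hcoord x) 0 j) == 0.
    apply/det0P; exists a; first exact: generic_neq0.
    rewrite -gx grad_Cconic; apply/rowP => j; rewrite mxE summxE.
    by apply: eq_bigr => i _; rewrite !mxE.
  have -> : \matrix_(i, j) grad (Qconic K i) (hcoord x) 0 j =
    map_mx (meval (hcoord x 0)) (\matrix_(i, j) (Qconic K i)^`M(j)).
    by apply/matrixP => i j; rewrite !mxE.
  rewrite det_map_mx det_jacobian_Qconic /= mevalZ mulf_eq0 oppr_eq0 pnatr_eq0.
  by move/eqP.
have := transv x xP Rx Cx; rewrite /transverse gx => /row_freeP[B BE].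
have /matrixP/(_ (rshift 1 0) (rshift 1 0))/eqP := BE.
rewrite mul_col_mx mul0mx col_mxEd !mxE eqxx.
by rewrite eq_sym oner_eq0.
Qed.

Lemma alphaCE w : peval (alphaC a) w =
  w 0 0 * grad (Cconic a) basept 0 0 + w 0 1 * grad (Cconic a) basept 0 1.
Proof.
by rewrite peval_lincomb sum_ord3 !peval_alphaQ !vec3E !grad_CconicE !mxE; ring.
Qed.

Lemma alphaC_neq0 : exists w, peval (alphaC a) w != 0.
Proof.
apply: contrapT => /forallNP H.
have E w : peval (alphaC a) w = 0 by apply/eqP/negPn/negP/H.
have := E (vec2 1 0); have := E (vec2 0 1).
rewrite !alphaCE !vec2E !mul0r !mul1r add0r addr0 => g1 g0.
have /eqP := generic_smooth (basept_neq0 K); apply.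
apply: rowP3; rewrite [RHS]mxE //.
suff -> : grad (Cconic a) basept 0 2%:R =
    - (grad (Cconic a) basept 0 0 + grad (Cconic a) basept 0 1).
  by rewrite g0 g1 addr0 oppr0.
by rewrite !grad_CconicE !mxE; ring.
Qed.

(** A common zero w of alphaC and betaC makes C contain the line through P with
direction w. On this line the gradient of C is s g + d, where g and d are its
values at P and at w; both are orthogonal to P and to w, hence proportional, so
that the gradient vanishes at some point of the line. *)
Lemma alphaC_betaC_coprime w : w != 0 ->
  peval (alphaC a) w = 0 -> peval (betaC a) w != 0.
Proof.
move=> w0 aw; apply/eqP => bw.
pose g := grad (Cconic a) basept; pose d := grad (Cconic a) (direction w).
have gradE s : grad (Cconic a) (pencil_pt s 1 w) = s *: g + d.
  apply/rowP => j; rewrite [RHS]mxE [in RHS]mxE /g /d !grad_CconicE.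
  by case: (ord3P j) => ->; rewrite !pencil_ptE !mxE /=; ring.
have gw : w 0 0 * g 0 0 + w 0 1 * g 0 1 = 0 by rewrite -alphaCE.
have dw : w 0 0 * d 0 0 + w 0 1 * d 0 1 = 0.
  rewrite -[RHS](mulr0 2%:R) -bw peval_lincomb sum_ord3 !peval_betaQ.
  by rewrite /d !grad_CconicE !vec3E; ring.
have g2 : g 0 2%:R = - (g 0 0 + g 0 1).
  by rewrite /g !grad_CconicE !mxE; ring.
have d2 : d 0 2%:R = - (d 0 0 + d 0 1).
  suff <- : peval (alphaC a) w - (d 0 0 + d 0 1) = d 0 2%:R by rewrite aw sub0r.
  by rewrite alphaCE /d !grad_CconicE !vec3E !mxE; ring.
have gd : g 0 0 * d 0 1 = g 0 1 * d 0 0.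
  have [w00|w00] := eqVneq (w 0 0) 0; last first.
    by apply: (mulfI w00); rewrite mulrA mulrCA;
      rewrite (_ : w 0 0 * g 0 0 = - (w 0 1 * g 0 1));
      [rewrite (_ : w 0 0 * d 0 0 = - (w 0 1 * d 0 1)); [ring|]|];
      apply/eqP; rewrite -addr_eq0; apply/eqP.
  have w01 : w 0 1 != 0.
    by apply: contraNneq w0 => w01; apply/eqP/rowP2; rewrite mxE.
  move/eqP: gw; rewrite w00 mul0r add0r mulf_eq0 (negbTE w01) => /eqP ->.
  move/eqP: dw; rewrite w00 mul0r add0r mulf_eq0 (negbTE w01) => /eqP ->.
  by rewrite ?(mulr0, mul0r).
have g0 : g != 0 by apply: generic_smooth; apply: basept_neq0.
have [s sE] : exists s, s *: g + d = 0.
  have [g00|g00] := eqVneq (g 0 0) 0.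
    have g01 : g 0 1 != 0.
      apply: contraNneq g0 => g01; apply/eqP/rowP3; rewrite [RHS]mxE //.
      by rewrite g2 g00 g01 addr0 oppr0.
    exists (- d 0 1 / g 0 1); apply: rowP3; rewrite [LHS]mxE [RHS]mxE mxE.
    - have /eqP := gd; rewrite g00 mul0r eq_sym mulf_eq0 (negbTE g01) => /eqP ->.
      by rewrite mulr0 addr0.
    - by rewrite mulfVK // addNr.
    rewrite g2 d2 g00; have /eqP := gd.
    rewrite g00 mul0r eq_sym mulf_eq0 (negbTE g01) => /eqP ->.
    by rewrite !add0r mulrN mulfVK // opprK subrr.
  exists (- d 0 0 / g 0 0); apply: rowP3; rewrite [LHS]mxE [RHS]mxE mxE.
  - by rewrite mulfVK // addNr.
  - by apply: (mulfI g00); rewrite mulr0 mulrDr gd; field.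
  by rewrite g2 d2; apply: (mulfI g00); rewrite mulr0 !(mulrN, mulrDr) gd; field.
have /eqP := gradE s; rewrite sE; apply/negP/generic_smooth.
apply: contraNneq w0 => v0.
have v i : pencil_pt s 1 w 0 i = 0 by rewrite v0 mxE.
move: (v 0) (v 1) (v 2%:R); rewrite !pencil_ptE !mul1r => v00 v01 s0.
by move: v00 v01; rewrite s0 !add0r => *; apply/eqP/rowP2; rewrite mxE.
Qed.

(** Otherwise C is the pair of lines Q1 = Q2, singular at (0 : 0 : 1). *)
Lemma generic_pencil : (a 0 0 + a 0 1 != 0) || (a 0 2%:R != 0).
Proof.
apply: contraTT (generic_smooth (v := vec3 0 0 1) _) => //.
  rewrite negb_or !negbK => /andP[/eqP b0 /eqP a2]; apply/eqP/rowP => j.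
  by rewrite grad_CconicE b0; case: (ord3P j) => ->; rewrite a2 !mxE /=; ring.
by apply/eqP => /rowP/(_ 2%:R)/eqP; rewrite !mxE /= oner_eq0.
Qed.

Lemma kulikov_surfaceP (z : P2P1) : kulikov_surface a z <->
  [/\ blowup z, bieval (Rhat K) z != 0 & bieval (Chat a) z != 0].
Proof.
have RP := strict_transformP (@Rcubic_expansion K) (alphaR_neq0 K)
  (@alphaR_betaR_coprime K) (@bihomog_Rhat K) (@Rhat_expansion K).
have CP := strict_transformP (@Cconic_expansion K a) alphaC_neq0
  alphaC_betaC_coprime (@bihomog_Chat K a) (@Chat_expansion K a).
split=> [[zb /not_orP[zR zC]]|[zb /eqP zR /eqP zC]].
  by split=> //; apply/eqP; [move/(RP _ zb)|move/(CP _ zb)].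
by split=> // -[/(RP _ zb)|/(CP _ zb)].
Qed.

End GenericConic.

(** * The Kulikov morphism in bihomogeneous coordinates *)

Section KulikovMorphism.
Variables (K : numFieldType) (a : 'rV[K]_3) (M : 'M[K]_(2, 3)).
Hypothesis generic_a : generic_conic a.
Hypothesis coords_M : (col_mx a M : 'M[K]_3) \in unitmx.
Notation S := (kulikov_surface a).
Notation P2P1 := (proj K 2 * proj K 1)%type.
Notation basept := (basept K).
Notation A := (kulikov_A (a := a) M).
Notation B := (kulikov_B (a := a)).
Implicit Types (s : S) (c x : 'rV[K]_3).

(** Homogeneous coordinates of F_S that are given by the same formula on E and
off E, unlike [kulikov_lift]. *)
Definition Yhat (z : P2P1) : 'rV[K]_3 := \row_i bieval (Qhat K i) z.

Lemma bieval_Chat z : bieval (Chat a) z = dot3 a (Yhat z).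
Proof. by rewrite /bieval peval_lincomb sum_ord3 dot3E !mxE. Qed.

Lemma direction_row_mx (w : 'rV[K]_2) :
  row_mx w (0 : 'rV_1) = direction w :> 'rV_3.
Proof.
apply/rowP => i; rewrite !mxE; case: (ord3P i) => ->; case: splitP => j //= jE.
- by congr (w _ _); apply: val_inj.
- by congr (w _ _); apply: val_inj.
- by have := ltn_ord j; rewrite -jE.
- by rewrite mxE.
Qed.

(** The scalar is l off E, where Q_i = l Qhat_i, and 1 / s on E, where Qhat_i is s
times the differential of Q_i. *)
Lemma kulikov_lift_Yhat (z : P2P1) : blowup z ->
  exists2 k, k != 0 & kulikov_lift z = k *: Yhat z.
Proof.
move=> /blowup_pencil_pt[s [l zE]]; rewrite /kulikov_lift.
have YE i : Yhat z 0 i = s * peval (alphaQ K i) (hcoord z.2) +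
    l * peval (betaQ K i) (hcoord z.2).
  by rewrite mxE /bieval zE Qhat_expansion.
have [l0|l0] := eqVneq l 0.
  have zP : is_basept z.1 by apply/(is_basept_pencil_pt zE).
  have s0 : s != 0.
    apply: contraNneq (hcoord_neq0 z.1) => s0; rewrite zE s0 l0.
    by rewrite /pencil_pt !scale0r addr0.
  rewrite asboolT //; exists s^-1; first by rewrite invr_eq0.
  apply/rowP => i; rewrite mxE [RHS]mxE YE l0 mul0r addr0 mulKf //.
  rewrite direction_row_mx -/(dot3 _ _) dot3E peval_alphaQ.
  rewrite !grad_Qconic !vec3E !mxE.
  by case: (ord3P i) => -> /=; ring.
rewrite asboolF; last by move/(is_basept_pencil_pt zE)/eqP; apply/negP.
exists l => //; apply/rowP => i.
by rewrite mxE [RHS]mxE YE zE Qconic_expansion expr1.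
Qed.

Lemma surfaceP s : [/\ blowup (val s), bieval (Rhat K) (val s) != 0 &
  dot3 a (Yhat (val s)) != 0].
Proof.
rewrite -bieval_Chat; apply/(kulikov_surfaceP generic_a).
exact: set_mem (valP s).
Qed.

(** The affine functions on the target plane: c stands for the linear form
c1 Y1 + c2 Y2 + c3 Y3 divided by the equation of L. *)
Definition ycoord c s : K := dot3 c (Yhat (val s)) / dot3 a (Yhat (val s)).

Lemma ycoordE s y k : Yhat (val s) = k *: y ->
  forall c, ycoord c s = dot3 c y / dot3 a y.
Proof.
have [_ _] := surfaceP s; rewrite /ycoord => + yE; rewrite yE.
have E c : dot3 c (k *: y) = k * dot3 c y by rewrite !dot3E !mxE; ring.
rewrite !E mulf_eq0 negb_or => /andP[k0 y0] c; rewrite E.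
by field; apply/andP.
Qed.

Lemma kulikov_mapE s j : kulikov_map M s 0 j = ycoord (row j M) s.
Proof.
have [zb _ aY] := surfaceP s; have [k k0 lE] := kulikov_lift_Yhat zb.
have lM : (kulikov_lift (val s) *m M^T) 0 j =
    k * dot3 (row j M) (Yhat (val s)).
  by rewrite lE /dot3 -scalemxAl !mxE; congr (_ * _);
    apply: eq_bigr => i _; rewrite !mxE.
have la : (kulikov_lift (val s) *m a^T) 0 0 = k * dot3 a (Yhat (val s)).
  by rewrite lE /dot3 -scalemxAl mxE.
by rewrite /kulikov_map /affine_coords mxE lM la /ycoord; field; apply/andP.
Qed.

(** Since a and the rows of M form a basis, c is a combination of them, and
dividing by the equation of L turns it into an affine polynomial. *)
Lemma ycoord_in_A c :
  exists P, forall s, peval P (kulikov_map M s) = ycoord c s.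
Proof.
pose e : 'rV_(1 + 2) := c *m invmx (col_mx a M : 'M_3).
exists ((lsubmx e 0 0)%:MP + \sum_j rsubmx e 0 j *: 'X_j) => s.
have [_ _ aY] := surfaceP s.
have cE : c = lsubmx e 0 0 *: a + \sum_j rsubmx e 0 j *: row j M.
  have eN : e *m col_mx a M = c := mulmxKV coords_M c.
  rewrite -{1}eN -{1}(hsubmxK e) mul_row_col.
  rewrite {1}[lsubmx e]mx11_scalar mul_scalar_mx; congr (_ + _).
  exact: mulmx_sum_row.
rewrite [in RHS]cE /peval mevalD mevalC raddf_sum /= !sum_ord2 !mevalZ !mevalXU.
rewrite !kulikov_mapE /ycoord; move: (Yhat _) aY => Y.
by rewrite !dot3E !mxE => aY; field.
Qed.

(** Points of S off E, and their images, without reference to the blowing-up. *)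
Lemma surface_pt_ex x :
  peval (Rcubic K) x != 0 -> peval (Cconic a) x != 0 ->
  exists s, (exists2 k, k != 0 & hcoord (val s).1 = k *: x) /\
    exists k, Yhat (val s) = k *: \row_i peval (Qconic K i) x.
Proof.
move=> Rx Cx; pose w := vec2 (x 0 0 - x 0 2%:R) (x 0 1 - x 0 2%:R).
have xE : x = pencil_pt (x 0 2%:R) 1 w.
  by apply: rowP3; rewrite !pencil_ptE ?vec2E; ring.
have x0 : x != 0.
  by apply: contraNneq Rx => ->; rewrite peval_Rcubic !mxE; apply/eqP; ring.
have w0 : w != 0.
  apply: contraNneq Rx => w0.
  by rewrite xE Rcubic_expansion w0 peval_alphaR peval_betaR !mxE; apply/eqP; ring.
have g0 : pencil_pt (x 0 2%:R) 1 w != 0 by rewrite -xE.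
have [z [k [k' [k0 k'0 zE wE zG]]]] := blowup_pt_ex w0 g0.
rewrite -xE in zE; set l := k * 1 / k' in zG.
have l0 : l != 0 by rewrite /l mulr1 mulf_neq0 ?invr_eq0.
have zb := pencil_pt_blowup zG.
have QY i : k ^+ 2 * peval (Qconic K i) x = l * Yhat z 0 i.
  rewrite mxE /bieval [in RHS]zG Qhat_expansion -[l in RHS]expr1.
  rewrite -Qconic_expansion -zG zE !peval_Qconic !mxE; ring.
have zS : kulikov_surface a z.
  apply/(kulikov_surfaceP generic_a); split=> //.
    have : l ^+ 2 * bieval (Rhat K) z != 0; last first.
      by rewrite mulf_eq0 negb_or => /andP[].
    rewrite /bieval [X in row_mx X]zG Rhat_expansion -Rcubic_expansion -zG zE.
    have -> : peval (Rcubic K) (k *: x) = k ^+ 3 * peval (Rcubic K) x.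
      by rewrite !peval_Rcubic !mxE; ring.
    by rewrite mulf_neq0 ?expf_neq0.
  have : l * bieval (Chat a) z != 0; last first.
    by rewrite mulf_eq0 negb_or => /andP[].
  have -> : l * bieval (Chat a) z = k ^+ 2 * peval (Cconic a) x.
    rewrite bieval_Chat peval_Cconic !dot3E !mulrDr.
    by congr (_ + _ + _); rewrite [RHS]mulrCA [in RHS]mxE QY mulrCA.
  by rewrite mulf_neq0 ?expf_neq0.
exists (exist _ z (mem_set zS)); split; first by exists k.
exists (k ^+ 2 / l); apply/rowP => i; rewrite [RHS]mxE [X in _ * X]mxE.
by rewrite mulrAC QY mulrAC divff // mul1r.
Qed.
Lemma regular_ratio d e (g h : {mpoly K[3 + 2]}) :
  bihomog d e g -> bihomog d e h -> (forall s, bieval h (val s) != 0) ->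
  B (fun s => bieval g (val s) / bieval h (val s)).
Proof.
move=> hg hh h0 s; exists setT, d, e, g, h; split=> // z zc.
have := zc 0%N 0%N 1%:MP (@bihomog_const K 1).
by rewrite /bieval /peval mevalC => H; move=> _; case/eqP: (oner_neq0 K);
  by apply: H => t; rewrite setCT.
Qed.

(** * Factorization of the pull-back of the line Y1 = Y2 *)

(** The line Y1 = Y2, whose inverse image is the pair of lines X1^2 = X2^2. *)
Definition split_line : S -> K := ycoord (vec3 1 (-1) 0).
(** The functions 3 (X1 - X2) Q / R and (X1 + X2) R / Q^2, in the form that is
also valid on E. *)
Definition factor1 s : K :=
  bieval (3%:R *: (wvar K 0 - wvar K 1) * Chat a) (val s) /
  bieval (Rhat K) (val s).
Definition factor2 s : K :=
  bieval ((xvar K 0 + xvar K 1) * Rhat K) (val s) /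
  bieval (Chat a * Chat a) (val s).

Lemma Chat_neq0 s : bieval (Chat a) (val s) != 0.
Proof. by rewrite bieval_Chat; case: (surfaceP s). Qed.

Lemma Rhat_neq0 s : bieval (Rhat K) (val s) != 0.
Proof. by case: (surfaceP s). Qed.

Lemma factor1_regular : B factor1.
Proof.
apply: (@regular_ratio 1 2); [|exact: bihomog_Rhat|exact: Rhat_neq0].
apply: (@bihomogM _ 0 1 1 1); last exact: bihomog_Chat.
by apply: bihomogZ; apply: bihomogB; apply: bihomog_wvar.
Qed.

Lemma factor2_regular : B factor2.
Proof.
apply: (@regular_ratio 2 2) => [||s]; last first.
- by rewrite bievalM mulf_neq0 ?Chat_neq0.
- by apply: (@bihomogM _ 1 1 1 1); apply: bihomog_Chat.
apply: (@bihomogM _ 1 0 1 2); last exact: bihomog_Rhat.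
by apply: bihomogD; apply: bihomog_xvar.
Qed.

Lemma split_lineE s :
  split_line s = bieval (Qhat K 0 - Qhat K 1) (val s) / bieval (Chat a) (val s).
Proof.
rewrite /split_line /ycoord bieval_Chat bievalB dot3E !vec3E !mxE.
by congr (_ / _); ring.
Qed.

Lemma split_line_regular : B split_line.
Proof.
rewrite (_ : split_line = fun s => bieval (Qhat K 0 - Qhat K 1) (val s)
  / bieval (Chat a) (val s)); last by apply/funext => s; apply: split_lineE.
apply: (@regular_ratio 1 1); [|exact: bihomog_Chat|exact: Chat_neq0].
by apply: bihomogB; apply: bihomog_Qhat.
Qed.

Lemma split_line_factor s : split_line s = factor1 s * factor2 s.
Proof.
have [/blowup_pencil_pt[u [l zE]] _ _] := surfaceP s.
have E : bieval (Qhat K 0 - Qhat K 1) (val s) =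
    3%:R * (hcoord (val s).2 0 0 - hcoord (val s).2 0 1) *
    (hcoord (val s).1 0 0 + hcoord (val s).1 0 1).
  by rewrite bievalB /bieval !peval_Qhat !vec3E zE !pencil_ptE; ring.
rewrite split_lineE E /factor1 /factor2; move: (Rhat_neq0 s) (Chat_neq0 s).
rewrite !bievalM; move: (bieval (Rhat K) _) (bieval (Chat a) _) => r k r0 k0.
by rewrite bievalZ bievalB bievalD !bieval_xvar !bieval_wvar; field; apply/andP.
Qed.

Let b := a 0 0 + a 0 1.
Let n := a 0 2%:R.

Lemma split_line0 s y k :
  Yhat (val s) = k *: y -> y 0 0 = y 0 1 -> split_line s = 0.
Proof.
move=> /ycoordE yE y01; rewrite /split_line yE dot3E !vec3E y01.
by rewrite mul1r mulN1r subrr mul0r addr0 mul0r.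
Qed.

(** The point is sought on X1 = 0, where Q1 - Q2 = -3 X2^2: for a non-zero, the
points (0 : 1 : 1), (0 : 1 : 2) and (0 : 1 : 3) are not all on C. *)
Lemma split_line_neq0_ex : exists s, split_line s != 0.
Proof.
pose C (t : K) := peval (Cconic a) (vec3 0 1 t).
have CE t : C t =
    - a 0 0 * t + a 0 1 * (3%:R - t) + n * (3%:R * t ^+ 2 - t).
  by rewrite /C peval_Cconic dot3E !mxE !peval_Qconic !vec3E /n; ring.
have [t [t0 tC]] : exists t : K, t + t ^+ 2 != 0 /\ C t != 0.
  apply: contrapT => /forallNP H.
  have C0 (m : nat) : C m.+1%:R = 0.
    apply/eqP/negPn/negP => Cm; apply: (H m.+1%:R); split=> //.
    by rewrite -natrX -natrD pnatr_eq0.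
  have n0 : n = 0.
    apply: (mulfI (x := 6%:R)); first by rewrite pnatr_eq0.
    have -> : 6%:R * n = C 1%:R - 2%:R * C 2%:R + C 3%:R by rewrite !CE; ring.
    by rewrite !C0 !mulr0 subr0 addr0.
  have a0 : a 0 0 = 0.
    apply: (mulfI (x := 3%:R)); first by rewrite pnatr_eq0.
    have -> : 3%:R * a 0 0 = 24%:R * n - C 3%:R by rewrite !CE; ring.
    by rewrite n0 C0 !mulr0 subr0.
  have a1 : a 0 1 = 0.
    have -> : a 0 1 = C 2%:R + 2%:R * a 0 0 - 10%:R * n by rewrite !CE; ring.
    by rewrite n0 a0 C0 !mulr0 addr0 subr0.
  by case/eqP: (generic_neq0 generic_a); apply: rowP3; rewrite mxE.
have Rt : peval (Rcubic K) (vec3 0 1 t) != 0.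
  suff -> : peval (Rcubic K) (vec3 0 1 t) = t + t ^+ 2 by [].
  by rewrite peval_Rcubic !vec3E; ring.
have [s [_ [k sE]]] := surface_pt_ex Rt tC; exists s.
rewrite /split_line (ycoordE sE) -(peval_Cconic a) mulf_neq0 ?invr_eq0 //.
suff -> : dot3 (vec3 1 (-1) 0) (\row_i peval (Qconic K i) (vec3 0 1 t)) =
  - 3%:R by rewrite oppr_eq0 pnatr_eq0.
by rewrite dot3E !mxE !peval_Qconic !vec3E /=; ring.
Qed.

(** The point is sought on X1 + X2 = 0, where p vanishes but X1 - X2 does not:
(1 : -1 : 1) or (1 : -1 : 2) will do. *)
Lemma factor1_neq0_ex : exists s, split_line s = 0 /\ factor1 s != 0.
Proof.
pose C (t : K) := peval (Cconic a) (vec3 1 (-1) t).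
have CE t : C t = 4%:R * b + n * (3%:R * t ^+ 2 + 1).
  by rewrite /C peval_Cconic dot3E !mxE !peval_Qconic !vec3E /n /b; ring.
have [t [t0 tC]] : exists t : K, t != 0 /\ C t != 0.
  apply: contrapT => /forallNP H.
  have C0 (m : nat) : C m.+1%:R = 0.
    apply/eqP/negPn/negP => Cm; apply: (H m.+1%:R); split=> //.
    by rewrite pnatr_eq0.
  have n0 : n = 0.
    apply: (mulfI (x := 9%:R)); first by rewrite pnatr_eq0.
    have -> : 9%:R * n = C 2%:R - C 1%:R by rewrite !CE; ring.
    by rewrite !C0 !mulr0 subr0.
  have b0 : b = 0.
    apply: (mulfI (x := 4%:R)); first by rewrite pnatr_eq0.
    have -> : 4%:R * b = C 1%:R - 4%:R * n by rewrite !CE; ring.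
    by rewrite n0 C0 !mulr0 subr0.
  by have := generic_pencil generic_a; rewrite -/b -/n b0 n0 eqxx.
have Rt : peval (Rcubic K) (vec3 1 (-1) t) != 0.
  suff -> : peval (Rcubic K) (vec3 1 (-1) t) = 8%:R * t.
    by rewrite mulf_neq0 ?pnatr_eq0.
  by rewrite peval_Rcubic !vec3E; ring.
have [s [[k k0 sx] [m sE]]] := surface_pt_ex Rt tC; exists s; split.
  by apply: (split_line0 sE); rewrite !mxE !peval_Qconic !vec3E; ring.
rewrite /factor1 mulf_neq0 ?invr_eq0 ?Rhat_neq0 //.
rewrite bievalM mulf_neq0 ?Chat_neq0 // bievalZ bievalB !bieval_wvar.
rewrite mulf_neq0 ?pnatr_eq0 //.
have [/blowup_pencil_pt[u [l zE]] _ _] := surfaceP s.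
rewrite subr_eq0; apply: contraNneq k0 => w01.
have /rowP E := sx; have := E 0; have := E 1; rewrite zE !pencil_ptE w01.
move=> ->; rewrite !mxE /= mulrN1 mulr1 => /eqP.
by rewrite eq_sym -addr_eq0 -mulr2n mulrn_eq0.
Qed.

(** * Primality in A of the equation of the line *)

(** The line Y1 = Y2 in the affine plane, where the equation of L is normalised to
1, is parametrised by t |-> (rho, rho, sigma); the coefficients b' and n' give
one of its points. *)
Section Line.
Variables b' n' : K.
Hypothesis bezout : b * b' + n * n' = 1.

Definition rho : {poly K} := b'%:P - n *: 'X.
Definition sigma : {poly K} := n'%:P + b *: 'X.

Lemma rho_sigma t : b * rho.[t] + n * sigma.[t] = 1.
Proof. by rewrite !hornerE -bezout; ring. Qed.

(** The parameters of the points of the line Y1 = Y2 that are images of points of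
the line X1 = X2 in S. *)
Definition good_locus : {poly K} := rho * (2%:R *: rho + sigma).

Lemma good_locus_neq0 : good_locus != 0.
Proof.
have lin (u v : K) : u%:P + v *: 'X = 0 -> u = 0 /\ v = 0.
  move=> /polyP E; have := E 0%N; have := E 1%N.
  by rewrite !coefE /= !(mulr0, mulr1, addr0, add0r) => -> ->.
have rhoE : rho = b'%:P + (- n) *: 'X by rewrite /rho scaleNr.
have sumE : 2%:R *: rho + sigma = (2%:R * b' + n')%:P + (b - 2%:R * n) *: 'X.
  rewrite /rho /sigma rmorphD rmorphM /= scalerBr scalerBl scalerA.
  by rewrite -mul_polyC rmorph_nat addrACA [- _ + _]addrC.
rewrite /good_locus mulf_neq0 //; apply/eqP.
  rewrite rhoE => /lin[b0 /eqP]; rewrite oppr_eq0 => /eqP n0.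
  by move: bezout; rewrite b0 n0 mulr0 mul0r addr0 => /esym/eqP; rewrite oner_eq0.
rewrite sumE => /lin[sum0 /eqP]; rewrite subr_eq0 => /eqP bE.
have : n * (2%:R * b' + n') = 1 by rewrite -[RHS]bezout bE; ring.
by rewrite sum0 mulr0 => /esym/eqP; rewrite oner_eq0.
Qed.

(** On X1 = X2 the map is (x : x : z) |-> (2x : 2x : - 3z - x), after division by
x - z; its inverse sends (rho : rho : sigma) to the point x of the proof. *)
Lemma good_locus_pt t : good_locus.[t] != 0 -> exists s,
  (exists k, Yhat (val s) = k *: vec3 rho.[t] rho.[t] sigma.[t]) /\
  factor2 s != 0.
Proof.
rewrite /good_locus hornerM [X in _ * X]hornerD hornerZ mulf_eq0 negb_or => /andP[].
have := rho_sigma t; set r := rho.[t]; set q := sigma.[t] => rq r0 q0.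
pose x := vec3 (3%:R * r) (3%:R * r) (- 2%:R * q - r).
have Rx : peval (Rcubic K) x != 0.
  suff -> : peval (Rcubic K) x = 24%:R * r * (2%:R * r + q) ^+ 2.
    by rewrite !mulf_neq0 ?expf_neq0 ?pnatr_eq0.
  by rewrite peval_Rcubic !vec3E; ring.
have QE : \row_i peval (Qconic K i) x = (12%:R * (2%:R * r + q)) *: vec3 r r q.
  by apply: rowP3; rewrite mxE [RHS]mxE peval_Qconic !vec3E; ring.
have Cx : peval (Cconic a) x != 0.
  suff -> : peval (Cconic a) x =
      12%:R * (2%:R * r + q) * (b * r + n * q).
    by rewrite rq mulr1 mulf_neq0 ?pnatr_eq0.
  by rewrite peval_Cconic QE dot3E !mxE /= /b /n; ring.
have [s [[k k0 sx] [m sE]]] := surface_pt_ex Rx Cx; exists s; split.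
  by exists (m * (12%:R * (2%:R * r + q))); rewrite sE QE scalerA.
rewrite /factor2 mulf_neq0 ?invr_eq0 //; last first.
  by rewrite bievalM mulf_neq0 ?Chat_neq0.
rewrite bievalM mulf_neq0 ?Rhat_neq0 // bievalD !bieval_xvar sx !mxE /=.
suff -> : k * (3%:R * r) + k * (3%:R * r) = 6%:R * (k * r).
  by rewrite !mulf_neq0 ?pnatr_eq0.
by ring.
Qed.

(** The affine coordinates of the points of the line, as polynomials in the
parameter. *)
Definition line_param (j : 'I_2) : {poly K} :=
  (M j 0 + M j 1) *: rho + M j 2%:R *: sigma.

(** A function on the plane that restricts to the parameter on the line. *)
Definition line_coord s : K :=
  b' * ycoord (vec3 0 0 1) s - n' * ycoord (vec3 0 1 0) s.

Lemma restrict_line g s t k :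
  Yhat (val s) = k *: vec3 rho.[t] rho.[t] sigma.[t] ->
  (restrict line_param g).[t] = peval g (kulikov_map M s).
Proof.
move=> sE; apply: horner_restrict => j.
rewrite kulikov_mapE (ycoordE sE) !dot3E !vec3E !mxE.
have -> : a 0 0 * rho.[t] + a 0 1 * rho.[t] + a 0 2%:R * sigma.[t] = 1.
  by rewrite -[RHS](rho_sigma t) mulrDl.
by rewrite divr1 [RHS]hornerD !hornerZ mulrDl.
Qed.

(** Division by an affine polynomial: modulo p, a point of the plane may be
replaced by the point of the line with the same [line_coord]. The property is
stable under sums and products, so it is enough to check the coordinates. *)
Lemma division_by_split_line g : exists q, forall s, peval g (kulikov_map M s) =
  split_line s * peval q (kulikov_map M s)
  + (restrict line_param g).[line_coord s].
Proof.
pose P g := exists q, forall s, peval g (kulikov_map M s) =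
  split_line s * peval q (kulikov_map M s)
  + (restrict line_param g).[line_coord s].
have PC (k : K) : P k%:MP.
  exists 0 => s; rewrite restrictC hornerC /peval mevalC rmorph0.
  by rewrite mulr0 add0r.
have PD f g1 : P f -> P g1 -> P (f + g1).
  move=> [q1 E1] [q2 E2]; exists (q1 + q2) => s.
  by rewrite restrictD hornerD !pevalD E1 E2; ring.
have PM f g1 : P f -> P g1 -> P (f * g1).
  have [p pE] := ycoord_in_A (vec3 1 (-1) 0).
  move=> [q1 E1] [q2 E2]; exists (q1 * g1 + (f - p * q1) * q2) => s.
  rewrite restrictM hornerM pevalM pevalD pevalM pevalM pevalB pevalM pE.
  by rewrite -/split_line E1 E2 -/(split_line s); ring.
(* The quotient is constant, as both sides are affine. *)
have PX j : P 'X_j.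
  exists ((M j 0 - a 0 0 * (b' * (M j 0 + M j 1) + n' * M j 2%:R))%:MP) => s.
  rewrite restrictX /peval mevalC mevalXU kulikov_mapE.
  have [_ _ aY] := surfaceP s; rewrite /split_line /line_coord /ycoord.
  move: (Yhat _) aY => Y aY; pose y i := Y 0 i / dot3 a Y.
  have yE c : dot3 c Y / dot3 a Y = c 0 0 * y 0 + c 0 1 * y 1 + c 0 2%:R * y 2%:R.
    by rewrite {1}dot3E /y !mulrDl !mulrA.
  have y1 : a 0 0 * y 0 + a 0 1 * y 1 + n * y 2%:R = 1 by rewrite -yE divff.
  rewrite !yE !vec3E !mxE !(mul0r, mul1r, add0r, addr0, mulN1r).
  set u := b' * y 2%:R - n' * y 1.
  have rhoE : rho.[u] = y 1 + b' * a 0 0 * (y 0 - y 1).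
    have E : y 1 = y 1 * (b * b' + n * n') by rewrite bezout mulr1.
    have E' : b' = b' * (a 0 0 * y 0 + a 0 1 * y 1 + n * y 2%:R).
      by rewrite y1 mulr1.
    by rewrite [X in _ = X + _]E /rho !hornerE {1}E'
      /u /b /n; ring.
  have sigmaE : sigma.[u] = y 2%:R + n' * a 0 0 * (y 0 - y 1).
    have E : y 2%:R = y 2%:R * (b * b' + n * n') by rewrite bezout mulr1.
    have E' : n' = n' * (a 0 0 * y 0 + a 0 1 * y 1 + n * y 2%:R).
      by rewrite y1 mulr1.
    by rewrite [X in _ = X + _]E /sigma !hornerE {1}E'
      /u /b /n; ring.
  by rewrite hornerD !hornerZ rhoE sigmaE; ring.
suff : forall f, P f by apply.
apply: mpolyind => [|k m f _ _ Pf]; first by rewrite -mpolyC0; apply: PC.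
apply: PD => //; rewrite -mul_mpolyC; apply: (PM); first exact: PC.
rewrite mpolyXE_id.
have P1 : P 1 by rewrite -mpolyC1; apply: PC.
apply: big_ind => [||i _]; [exact: P1|exact: PM|].
elim: (m i) => [|d Pd]; first by rewrite expr0.
by rewrite exprS; apply: PM.
Qed.

(** The remainders of the two factors are univariate polynomials whose product
vanishes on the good locus, so one of them is zero. *)
Lemma split_line_prime_in_A : prime_in A split_line.
Proof.
have [s0 [qs0 _]] := factor1_neq0_ex.
split.
- have [p pE] := ycoord_in_A (vec3 1 (-1) 0); exists p => //.
  by apply/funext => s; apply: pE.
- have [s qs] := split_line_neq0_ex; apply: contraNneq qs => q0.
  by rewrite q0.
- move=> [_ [q _ /(congr1 (fun f => f s0))/eqP]].
  by rewrite mulrfctE qs0 mul0r; apply/negP/oner_neq0.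
move=> _ _ [f _ <-] [g _ <-] [_ [q _ <-] /(congr1 (fun f => f _)) fgE].
have fg0 : restrict line_param f * restrict line_param g = 0.
  apply: (poly_eq0_off good_locus_neq0) => t /good_locus_pt[s [[k sE] _]].
  rewrite hornerM !(restrict_line _ sE).
  have := fgE s; rewrite !mulrfctE (split_line0 sE) ?vec3E // mul0r.
  exact.
have divides h : restrict line_param h = 0 ->
    divides_in A split_line (kulikov_comorph M h).
  move=> h0; have [r rE] := division_by_split_line h.
  exists (kulikov_comorph M r); first by exists r.
  by apply/funext => s; rewrite mulrfctE /kulikov_comorph rE h0 horner0 addr0.
by move/eqP: fg0; rewrite mulf_eq0 => /orP[]/eqP/divides; [left|right].
Qed.

End Line.

Lemma bezout_ex : exists b' n', b * b' + n * n' = 1.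
Proof.
have /orP[b0|n0] := generic_pencil generic_a.
  by exists b^-1, 0; rewrite mulr0 addr0 divff.
by exists 0, n^-1; rewrite mulr0 add0r divff.
Qed.

(** A multiple of p vanishes wherever p does, but f1 is non-zero at a point of
X1 + X2 = 0, and f2 at a point of X1 = X2. *)
Lemma split_line_ndvd_factors (q : S -> K) :
  factor1 <> split_line * q /\ factor2 <> split_line * q.
Proof.
split=> /(congr1 (fun f => f _)) fE.
  have [s [qs]] := factor1_neq0_ex.
  by rewrite fE mulrfctE qs mul0r eqxx.
have [b' [n' bez]] := bezout_ex.
have [t tg] := poly_neq0_ex (good_locus_neq0 bez).
have [s [[k sE] /eqP]] := good_locus_pt bez tg; apply.
by rewrite fE mulrfctE (split_line0 sE) ?vec3E // mul0r.
Qed.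

Lemma split_line_factorization : split_line = factor1 * factor2.
Proof. by apply/funext => s; rewrite mulrfctE split_line_factor. Qed.

Theorem kulikov_not_mult_closed : ~ mult_closed A B /\
  exists p : S -> K, [/\ B p, prime_in A p & ~ prime_in B p].
Proof.
have [b' [n' /split_line_prime_in_A quotA]] := bezout_ex.
have [Aq q0 _ Aprime] := quotA.
have [f10 f20] : factor1 != 0 /\ factor2 != 0.
  by split; apply: contraNneq q0 => f0;
    rewrite split_line_factorization f0 ?mul0r ?mulr0.
have ndvd D :
    ~ (divides_in D split_line factor1 \/ divides_in D split_line factor2).
  by move=> [[q _]|[q _]]; case: (split_line_ndvd_factors q).
split.
  move=> /(_ _ _ factor1_regular factor2_regular f10 f20).
  rewrite -split_line_factorization => /(_ Aq)[A1 A2].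
  apply/(ndvd A)/Aprime => //; rewrite -split_line_factorization.
  exists 1; last by rewrite mulr1.
  exists 1 => //; apply/funext => s.
  by rewrite /kulikov_comorph /peval rmorph1.
exists split_line; split=> //; first exact: split_line_regular.
move=> [_ _ _ Bprime]; apply/(ndvd B)/Bprime.
- exact: factor1_regular.
- exact: factor2_regular.
rewrite -split_line_factorization; exists 1; last by rewrite mulr1.
rewrite (_ : 1 = fun s => bieval 1%:MP (val s) / bieval 1%:MP (val s)).
  apply: (@regular_ratio 0 0) => [||s]; try exact: bihomog_const.
  by rewrite /bieval /peval mevalC oner_neq0.
by apply/funext => s; rewrite /bieval /peval mevalC divr1.
Qed.

End KulikovMorphism.

Theorem corollary3 (R : realType) (a : 'rV[R[i]]_3) (M : 'M[R[i]]_(2, 3))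
  (generic_a : generic_conic a)
  (coords_M : (col_mx a M : 'M[R[i]]_3) \in unitmx) :
  ~ mult_closed (kulikov_A (a := a) M) (kulikov_B (a := a)) /\
  exists p : kulikov_surface a -> R[i],
    [/\ kulikov_B p, prime_in (kulikov_A (a := a) M) p
       & ~ prime_in (kulikov_B (a := a)) p].
Proof. exact: kulikov_not_mult_closed. Qed.
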